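(* Let $A\in\mathbb{C}^{m\times n}$ and $B\in\mathbb{C}^{n\times \ell}$, and let $M,N,L$ be weights of order $m,n,\ell$ respectively, such that $A^{[\dagger]}$ and $B^{[\dagger]}$ exist. Suppose $$\operatorname{rank}\begin{pmatrix} B^{[*]}A^{[*]} & B^{[*]}B\\ AA^{[*]} & AB\end{pmatrix}=\operatorname{rank}\begin{pmatrix}A^{[*]} & B\end{pmatrix}.$$ Then the statement ''$(AB)^{[\dagger]}$ exists and $(AB)^{[\dagger]}=B^{[\dagger]}A^{[\dagger]}$'' is equivalent to each one of the following conditions: (i) $A^{[*]}ABB^{[*]}$ is range Hermitian. (ii) $R(A^{[*]}AB)\subseteq R(B)$ and $R(BB^{[*]}A^{[*]})\subseteq R(A^{[*]})$. (iii) $BB^{[\dagger]}A^{[*]}A$ and $A^{[\dagger]}ABB^{[*]}$ are range Hermitian. (iv) $BB^{[\dagger]}A^{[*]}AB=A^{[*]}AB$ and $A^{[\dagger]}ABB^{[*]}A^{[*]}=BB^{[*]}A^{[*]}$.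
   Context: All matrices are complex, $X^*$ denotes the complex conjugate transpose and $R(X)$ the range (column space) of $X$. A weight of order $n$ is an invertible Hermitian $n\times n$ matrix (not necessarily positive definite). The spaces $\mathbb{C}^m,\mathbb{C}^n,\mathbb{C}^\ell$ carry fixed weights $M,N,L$. The adjoint of a matrix $X\in\mathbb{C}^{p\times q}$ between spaces with weights $W_p$ (on $\mathbb{C}^p$) and $W_q$ (on $\mathbb{C}^q$) is $X^{[*]}=W_q^{-1}X^*W_p$; thus $A^{[*]}=N^{-1}A^*M$, $B^{[*]}=L^{-1}B^*N$, and a square matrix $X$ acting on $\mathbb{C}^n$ has $X^{[*]}=N^{-1}X^*N$. A square matrix $X\in\mathbb{C}^{n\times n}$ is range Hermitian (with respect to $N$) if $R(X)=R(X^{[*]})$. The Moore-Penrose inverse $X^{[\dagger]}$ of $X\in\mathbb{C}^{p\times q}$ is the unique $Y\in\mathbb{C}^{q\times p}$, if it exists, satisfying $XYX=X$, $YXY=Y$, $(XY)^{[*]}=XY$ and $(YX)^{[*]}=YX$. It need not exist. *)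

(* Defs.v *)
From mathcomp Require Import all_boot all_order all_algebra.
From mathcomp Require Import complex.
From mathcomp Require Import classical_sets reals.

Set Implicit Arguments.
Unset Strict Implicit.
Unset Printing Implicit Defensive.

Import Order.TTheory GRing.Theory Num.Theory.

Local Open Scope classical_set_scope.
Local Open Scope ring_scope.
Local Open Scope sesquilinear_scope.

Definition is_weight (C : numClosedFieldType) (n : nat) (W : 'M[C]_n) : Prop :=
  W \is hermsymmx /\ W \in unitmx.

(* For X of size p x q, the weight Wp of the codomain C^p comes first and the
   weight Wq of the domain C^q second. *)
Definition adjmx (C : numClosedFieldType) (p q : nat)
    (Wp : 'M[C]_p) (Wq : 'M[C]_q) (X : 'M[C]_(p, q)) : 'M[C]_(q, p) :=
  invmx Wq *m X ^t* *m Wp.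

(* Column space; note that the row-space operators of mxalgebra would need a
   transposition here. *)
Definition mxrange (C : numClosedFieldType) (p q : nat) (X : 'M[C]_(p, q)) :
    set 'cV[C]_p :=
  range (fun u : 'cV[C]_q => X *m u).

Definition range_hermitian (C : numClosedFieldType) (n : nat)
    (W X : 'M[C]_n) : Prop :=
  mxrange X = mxrange (adjmx W W X).

(* A relation rather than a function, because for indefinite weights the
   inverse need not exist; it is functional by [is_mpinv_unique]. *)
Definition is_mpinv (C : numClosedFieldType) (p q : nat)
    (Wp : 'M[C]_p) (Wq : 'M[C]_q) (X : 'M[C]_(p, q)) (Y : 'M[C]_(q, p)) : Prop :=
  [/\ X *m Y *m X = X,
      Y *m X *m Y = Y,
      adjmx Wp Wp (X *m Y) = X *m Y
    & adjmx Wq Wq (Y *m X) = Y *m X].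

Lemma adjmxM (C : numClosedFieldType) (n : nat) (W U V : 'M[C]_n) :
  is_weight W -> adjmx W W (U *m V) = adjmx W W V *m adjmx W W U.
Proof.
by case=> _ Wu; rewrite /adjmx trmx_mul map_mxM /= !mulmxA mulmxK.
Qed.

Lemma is_mpinv_unique (C : numClosedFieldType) (p q : nat)
    (Wp : 'M[C]_p) (Wq : 'M[C]_q) (X : 'M[C]_(p, q)) (Y Z : 'M[C]_(q, p)) :
  is_weight Wp -> is_weight Wq ->
  is_mpinv Wp Wq X Y -> is_mpinv Wp Wq X Z -> Y = Z.
Proof.
move=> wp wq [XYX YXY hXY hYX] [XZX ZXZ hXZ hZX].
have eXY : X *m Y = X *m Z.
  rewrite -[in LHS]XZX -[X *m Z *m X *m Y]mulmxA -hXZ -hXY -adjmxM //.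
  by rewrite mulmxA XYX.
have eYX : Y *m X = Z *m X.
  rewrite -[X in Y *m X]XZX -[X *m Z *m X]mulmxA mulmxA -hYX -hZX -adjmxM //.
  by rewrite -mulmxA [X *m (Y *m X)]mulmxA XYX.
by rewrite -YXY eYX -mulmxA eXY mulmxA ZXZ.
Qed.

(* Main.v *)
Require Import Defs.
From mathcomp Require Import all_boot all_order all_algebra.
From mathcomp Require Import complex.
From mathcomp Require Import classical_sets reals.

Set Implicit Arguments.
Unset Strict Implicit.
Unset Printing Implicit Defensive.

Import Order.TTheory GRing.Theory Num.Theory.

Local Open Scope classical_set_scope.
Local Open Scope ring_scope.

(** Write P = A^[†] A and Q = B B^[†]; these are the self-adjoint projections
    onto R(A^[*]) and R(B).  Write S = A^[*] A and T = B B^[*]; these are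
    self-adjoint, with the same ranges as P and Q.  Each of the five statements
    says that Q commutes with S and P commutes with T.

    For (i)-(iv) this needs no hypothesis on the rank, because of one remark: if
    Q and S are self-adjoint and Q S Q = S Q, so that R(S Q) lies in R(Q), then
    taking adjoints gives Q S Q = Q S and hence Q S = S Q
    ([compression_commute]).  Every condition among (i)-(iv) yields this
    inclusion for the pair (Q, S), and the analogous one for (P, T).

    If Q commutes with S then it preserves R(S) = R(P), so P and Q commute too;
    the first two Penrose equations for B^[†] A^[†] follow, and the last two are
    the commutation relations for S and T ([reverse_order_of_commute]).

    In the other direction the reverse order law gives at once P Q P Q = P Q, and
    once P Q = Q P its self-adjointness conditions become the two commutation
    relations.  With a positive definite weight P Q = Q P would follow from
    idempotency; here it comes from the rank condition.  The block matrix is the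
    product X^[*] X for X = (A^[*] B), so the condition says that X^[*] X u = 0
    forces X u = 0: the subspace R(A^[*]) + R(B) is nondegenerate.  The columns
    of P Q - Q P Q lie in that subspace and are killed by both P and Q, hence
    vanish ([projections_commute_of_rank]).

    The pair (A, B) may be replaced by (B^[*], A^[*]), which exchanges (P, S)
    and (Q, T); so each fact about one of the two commutation relations also
    gives the other. *)

(** * Weighted adjoints and ranges *)

Lemma adjmx_mul (C : numClosedFieldType) (p q r : nat)
    (Wp : 'M[C]_p) (Wq : 'M[C]_q) (Wr : 'M[C]_r)
    (X : 'M[C]_(p, q)) (Y : 'M[C]_(q, r)) :
  is_weight Wq ->
  adjmx Wp Wr (X *m Y) = adjmx Wq Wr Y *m adjmx Wp Wq X.
Proof.
by case=> _ Wu; rewrite /adjmx trmx_mul map_mxM /= !mulmxA mulmxK.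
Qed.

Lemma adjmxK (C : numClosedFieldType) (p q : nat)
    (Wp : 'M[C]_p) (Wq : 'M[C]_q) (X : 'M[C]_(p, q)) :
  is_weight Wp -> is_weight Wq ->
  adjmx Wq Wp (adjmx Wp Wq X) = X.
Proof.
move=> [hp up] [hq uq].
have herm k (W : 'M[C]_k) :
    W \is hermsymmx -> map_mx Num.conj (trmx W) = W.
  by rewrite is_hermitianmxE expr0 scale1r => /eqP <-.
rewrite /adjmx !trmx_mul !map_mxM /= trmxCK trmx_inv map_invmx !herm //.
by rewrite !mulmxA mulVmx // mul1mx -mulmxA mulVmx // mulmx1.
Qed.

Lemma mxrange_mul (C : numClosedFieldType) (p q r : nat)
    (X : 'M[C]_(p, q)) (K : 'M[C]_(q, r)) :
  mxrange (X *m K) `<=` mxrange X.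
Proof. by move=> _ [u _ <-]; exists (K *m u) => //; rewrite mulmxA. Qed.

Lemma mulmx_fix_range (C : numClosedFieldType) (p q r : nat)
    (Q : 'M[C]_p) (X : 'M[C]_(p, q)) (Y : 'M[C]_(p, r)) :
  mxrange X `<=` mxrange Y -> Q *m Y = Y -> Q *m X = X.
Proof.
move=> sXY QY; apply/trmx_inj/row_matrixP=> k; rewrite -!tr_col; congr (_^T).
rewrite !colE -mulmxA.
have [|u _ <-] := sXY (X *m delta_mx k 0); first by exists (delta_mx k 0).
by rewrite mulmxA QY.
Qed.

Lemma mxrange_sub_fix (C : numClosedFieldType) (p q r : nat)
    (X : 'M[C]_(p, q)) (Y : 'M[C]_(p, r)) (Z : 'M[C]_(r, p)) :
  Y *m Z *m Y = Y -> mxrange X `<=` mxrange Y <-> Y *m Z *m X = X.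
Proof.
move=> YZY; split=> [sXY|<-]; first exact: mulmx_fix_range YZY.
by rewrite -mulmxA; apply: mxrange_mul.
Qed.

(** The equality of ranks makes the row space of [Y *m X] equal to that of
    [X], so that [X] can be recovered from [Y *m X]. *)
Lemma mulmx_eq0_rank (F : fieldType) (p q r s : nat)
    (Y : 'M[F]_(p, q)) (X : 'M[F]_(q, r)) (K : 'M[F]_(r, s)) :
  \rank (Y *m X) = \rank X -> Y *m X *m K = 0 -> X *m K = 0.
Proof.
move=> eqr YXK0.
have /submxP[D ->] : (X <= Y *m X)%MS.
  by rewrite -(mxrank_leqif_sup (submxMl Y X)) eqr.
by rewrite -mulmxA YXK0 mulmx0.
Qed.

(** * Self-adjoint projections *)

(** Q S Q is self-adjoint, so if it equals S Q it also equals Q S. *)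
Lemma compression_commute (C : numClosedFieldType) (n : nat)
    (W Q S : 'M[C]_n) :
  is_weight W -> adjmx W W Q = Q -> Q *m Q = Q -> adjmx W W S = S ->
  Q *m S *m Q = S *m Q <-> Q *m S = S *m Q.
Proof.
move=> w hQ QQ hS; split=> [e | ->]; last by rewrite -mulmxA QQ.
have := congr1 (adjmx W W) e.
by rewrite !(adjmx_mul _ _ _ _ w) hQ hS mulmxA e => <-.
Qed.

(** The last two clauses say that R(P) = R(S) and that [P] is the identity
    there, so [P] is idempotent. *)
Definition range_projection (C : numClosedFieldType) (n : nat)
    (W S P : 'M[C]_n) : Prop :=
  [/\ adjmx W W P = P, P *m S = S & exists K, P = S *m K].

Lemma range_projection_idem (C : numClosedFieldType) (n : nat)
    (W S P : 'M[C]_n) :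
  range_projection W S P -> P *m P = P.
Proof. by case=> _ PS [K eP]; rewrite {2}eP mulmxA PS. Qed.

Lemma range_projection_mulr (C : numClosedFieldType) (n : nat)
    (W S P : 'M[C]_n) :
  is_weight W -> adjmx W W S = S -> range_projection W S P -> S *m P = S.
Proof.
by move=> w hS [hP PS _]; rewrite -{1}hS -{1}hP -(adjmx_mul _ _ _ _ w) PS.
Qed.

(** A self-adjoint [Q] that commutes with [S] preserves the range of [S],
    which is that of [P]. *)
Lemma commute_range_projection (C : numClosedFieldType) (n : nat)
    (W S P Q : 'M[C]_n) :
  is_weight W -> adjmx W W Q = Q -> range_projection W S P ->
  Q *m S = S *m Q -> P *m Q = Q *m P.
Proof.
move=> w hQ pP QS; have PP := range_projection_idem pP.
case: (pP) => hP PS [K eP]; apply/(compression_commute w hP PP hQ).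
by rewrite -mulmxA {2 3}eP !mulmxA -(mulmxA P) QS !mulmxA PS.
Qed.

(** The adjoint of Q S is S Q, and R(Q S) is contained in R(Q). *)
Lemma range_hermitian_compression (C : numClosedFieldType) (n : nat)
    (W Q S : 'M[C]_n) :
  is_weight W -> adjmx W W Q = Q -> Q *m Q = Q -> adjmx W W S = S ->
  range_hermitian W (Q *m S) <-> Q *m S = S *m Q.
Proof.
move=> w hQ QQ hS; rewrite /range_hermitian (adjmx_mul _ _ _ _ w) hQ hS.
split=> [e | -> //]; apply/(compression_commute w hQ QQ hS); rewrite -mulmxA.
by apply: (@mulmx_fix_range _ _ _ _ _ _ Q) => //; rewrite -e; apply: mxrange_mul.
Qed.

(** R(Q) is contained in R(T), so R(S Q) is contained in
    R(S T) = R(T S), hence in R(T), on which [Q] is the identity. *)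
Lemma commute_of_range_hermitian (C : numClosedFieldType) (n : nat)
    (W S T Q : 'M[C]_n) :
  is_weight W -> adjmx W W S = S -> adjmx W W T = T ->
  range_projection W T Q -> range_hermitian W (S *m T) -> Q *m S = S *m Q.
Proof.
move=> w hS hT pQ; have QQ := range_projection_idem pQ.
case: (pQ) => hQ QT [K eQ].
rewrite /range_hermitian (adjmx_mul _ _ _ _ w) hS hT => e.
apply/(compression_commute w hQ QQ hS); rewrite -mulmxA.
apply: (@mulmx_fix_range _ _ _ _ _ _ T) => //.
apply: (@subset_trans _ (mxrange (S *m T))); last by rewrite e; apply: mxrange_mul.
by rewrite eQ mulmxA; apply: mxrange_mul.
Qed.

(** R(S T) is contained in R(P) and in R(Q), and the product of the commuting
    projections is P Q = P T K = T P K = T S H. *)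
Lemma mxrange_commute_sub (C : numClosedFieldType) (n : nat)
    (W S T P Q : 'M[C]_n) :
  range_projection W S P -> range_projection W T Q ->
  Q *m S = S *m Q -> P *m T = T *m P ->
  mxrange (S *m T) `<=` mxrange (T *m S).
Proof.
move=> [_ PS [H eP]] [_ QT [K eQ]] QS PT.
have -> : S *m T = T *m S *m (H *m K *m S *m T).
  (* S T = S Q T = Q S T; the factor Q = T K is then moved past P. *)
  transitivity (P *m Q *m S *m T).
    by rewrite -(mulmxA P) QS -!mulmxA QT mulmxA PS.
  by rewrite eQ !mulmxA PT eP !mulmxA.
exact: mxrange_mul.
Qed.

Lemma range_hermitian_mul (C : numClosedFieldType) (n : nat)
    (W S T P Q : 'M[C]_n) :
  is_weight W -> adjmx W W S = S -> adjmx W W T = T ->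
  range_projection W S P -> range_projection W T Q ->
  range_hermitian W (S *m T) <-> Q *m S = S *m Q /\ P *m T = T *m P.
Proof.
move=> w hS hT pP pQ; split=> [e | [QS PT]].
  split; first exact: commute_of_range_hermitian e.
  apply: (commute_of_range_hermitian w hT hS pP).
  by move: e; rewrite /range_hermitian !(adjmx_mul _ _ _ _ w) hS hT.
rewrite /range_hermitian (adjmx_mul _ _ _ _ w) hS hT.
by apply/seteqP; split; apply: mxrange_commute_sub; eassumption.
Qed.

(** * Moore-Penrose inverses *)

Lemma is_mpinv_adj (C : numClosedFieldType) (p q : nat)
    (Wp : 'M[C]_p) (Wq : 'M[C]_q) (X : 'M[C]_(p, q)) (Y : 'M[C]_(q, p)) :
  is_weight Wp -> is_weight Wq -> is_mpinv Wp Wq X Y ->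
  is_mpinv Wq Wp (adjmx Wp Wq X) (adjmx Wq Wp Y).
Proof.
move=> wp wq [XYX YXY hXY hYX]; split.
- by rewrite -mulmxA -(adjmx_mul _ _ _ _ wq) -(adjmx_mul _ _ _ _ wp) XYX.
- by rewrite -mulmxA -(adjmx_mul _ _ _ _ wp) -(adjmx_mul _ _ _ _ wq) YXY.
- by rewrite -(adjmx_mul _ _ _ _ wp) hYX hYX.
- by rewrite -(adjmx_mul _ _ _ _ wq) hXY hXY.
Qed.

Lemma adjmx_gram (C : numClosedFieldType) (p q : nat)
    (Wp : 'M[C]_p) (Wq : 'M[C]_q) (X : 'M[C]_(p, q)) :
  is_weight Wp -> is_weight Wq ->
  adjmx Wq Wq (adjmx Wp Wq X *m X) = adjmx Wp Wq X *m X.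
Proof. by move=> wp wq; rewrite (adjmx_mul _ _ _ _ wp) adjmxK. Qed.

Lemma adjmx_cogram (C : numClosedFieldType) (p q : nat)
    (Wp : 'M[C]_p) (Wq : 'M[C]_q) (X : 'M[C]_(p, q)) :
  is_weight Wp -> is_weight Wq ->
  adjmx Wp Wp (X *m adjmx Wp Wq X) = X *m adjmx Wp Wq X.
Proof. by move=> wp wq; rewrite (adjmx_mul _ _ _ _ wq) adjmxK. Qed.

(** Taking the adjoint of X (Y X) = X. *)
Lemma mpinv_mul_adj (C : numClosedFieldType) (p q : nat)
    (Wp : 'M[C]_p) (Wq : 'M[C]_q) (X : 'M[C]_(p, q)) (Y : 'M[C]_(q, p)) :
  is_weight Wq -> is_mpinv Wp Wq X Y ->
  Y *m X *m adjmx Wp Wq X = adjmx Wp Wq X.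
Proof.
move=> wq [XYX _ _ hYX].
by rewrite -{1}hYX -(adjmx_mul _ _ _ _ wq) mulmxA XYX.
Qed.

Lemma mpinv_adj_mul (C : numClosedFieldType) (p q : nat)
    (Wp : 'M[C]_p) (Wq : 'M[C]_q) (X : 'M[C]_(p, q)) (Y : 'M[C]_(q, p)) :
  is_weight Wp -> is_mpinv Wp Wq X Y ->
  adjmx Wp Wq X *m (X *m Y) = adjmx Wp Wq X.
Proof.
move=> wp [XYX _ hXY _].
by rewrite -{1}hXY -(adjmx_mul _ _ _ _ wp) XYX.
Qed.

Lemma adjmx_mpinv_mul (C : numClosedFieldType) (p q : nat)
    (Wp : 'M[C]_p) (Wq : 'M[C]_q) (X : 'M[C]_(p, q)) (Y : 'M[C]_(q, p)) :
  is_weight Wp -> is_mpinv Wp Wq X Y ->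
  adjmx Wp Wq X *m adjmx Wq Wp Y = Y *m X.
Proof. by move=> wp [_ _ _ hYX]; rewrite -(adjmx_mul _ _ _ _ wp). Qed.

(** The range inclusion comes from X Y = X (Y X) Y = X X^[*] (Y^[*] Y). *)
Lemma mpinv_range_projection (C : numClosedFieldType) (p q : nat)
    (Wp : 'M[C]_p) (Wq : 'M[C]_q) (X : 'M[C]_(p, q)) (Y : 'M[C]_(q, p)) :
  is_weight Wp -> is_mpinv Wp Wq X Y ->
  range_projection Wp (X *m adjmx Wp Wq X) (X *m Y).
Proof.
move=> wp XY; case: (XY) => XYX YXY hXY _; split=> //; first by rewrite mulmxA XYX.
exists (adjmx Wq Wp Y *m Y).
by rewrite mulmxA -(mulmxA X) (adjmx_mpinv_mul wp XY) mulmxA XYX.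
Qed.

Lemma mpinv_corange_projection (C : numClosedFieldType) (p q : nat)
    (Wp : 'M[C]_p) (Wq : 'M[C]_q) (X : 'M[C]_(p, q)) (Y : 'M[C]_(q, p)) :
  is_weight Wp -> is_weight Wq -> is_mpinv Wp Wq X Y ->
  range_projection Wq (adjmx Wp Wq X *m X) (Y *m X).
Proof.
move=> wp wq XY; have := mpinv_range_projection wq (is_mpinv_adj wp wq XY).
by rewrite adjmxK // (adjmx_mpinv_mul wp XY).
Qed.

Lemma mul_mpinv_fix_commute (C : numClosedFieldType) (p q : nat)
    (Wp : 'M[C]_p) (Wq : 'M[C]_q) (X : 'M[C]_(p, q)) (Y : 'M[C]_(q, p))
    (S : 'M[C]_p) :
  is_weight Wp -> is_mpinv Wp Wq X Y -> adjmx Wp Wp S = S ->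
  X *m Y *m (S *m X) = S *m X <-> X *m Y *m S = S *m (X *m Y).
Proof.
move=> wp XY hS; have QQ := range_projection_idem (mpinv_range_projection wp XY).
case: XY => XYX _ hXY _; rewrite -(compression_commute wp hXY QQ hS); split=> e.
  by rewrite mulmxA -(mulmxA _ S X) e mulmxA.
have -> : S *m X = S *m (X *m Y) *m X by rewrite -mulmxA XYX.
by rewrite !(mulmxA (X *m Y)) e.
Qed.

(** * The reverse order law *)

(** Since X = Y^[*] S and S Y = X^[*], the matrix X Q Y is Y^[*] (S Q) Y, and
    its adjoint is Y^[*] (Q S) Y. *)
Lemma adjmx_conj_mpinv (C : numClosedFieldType) (p q : nat)
    (Wp : 'M[C]_p) (Wq : 'M[C]_q) (X : 'M[C]_(p, q)) (Y : 'M[C]_(q, p))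
    (Q : 'M[C]_q) :
  is_weight Wp -> is_weight Wq -> is_mpinv Wp Wq X Y -> adjmx Wq Wq Q = Q ->
  let S := adjmx Wp Wq X *m X in
  Q *m S = S *m Q -> adjmx Wp Wp (X *m Q *m Y) = X *m Q *m Y.
Proof.
move=> wp wq XY hQ S QS; case: (XY) => XYX _ hXY _.
have eX : adjmx Wq Wp Y *m S = X.
  by rewrite mulmxA -(adjmx_mul _ _ _ _ wq) hXY XYX.
have eS : S *m Y = adjmx Wp Wq X by rewrite -mulmxA (mpinv_adj_mul wp XY).
rewrite !(adjmx_mul _ _ _ _ wq) hQ -eS -{1}eX.
by rewrite -(mulmxA _ S Q) -QS !mulmxA.
Qed.

(** Multiplying the equation (X Q Y)^[*] = X Q Y by X^[*] on the left and by X
    on the right gives P Q S = S Q P for P = Y X.  As P commutes with Q and is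
    absorbed by S, this is Q S = S Q. *)
Lemma commute_of_conj_mpinv (C : numClosedFieldType) (p q : nat)
    (Wp : 'M[C]_p) (Wq : 'M[C]_q) (X : 'M[C]_(p, q)) (Y : 'M[C]_(q, p))
    (Q : 'M[C]_q) :
  is_weight Wp -> is_weight Wq -> is_mpinv Wp Wq X Y -> adjmx Wq Wq Q = Q ->
  let S := adjmx Wp Wq X *m X in
  Y *m X *m Q = Q *m (Y *m X) ->
  adjmx Wp Wp (X *m Q *m Y) = X *m Q *m Y -> Q *m S = S *m Q.
Proof.
move=> wp wq XY hQ S PQ; rewrite !(adjmx_mul _ _ _ _ wq) hQ => e.
have pP := mpinv_corange_projection wp wq XY.
have SP : S *m (Y *m X) = S.
  exact: range_projection_mulr (adjmx_gram _ wp wq) pP.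
have PS : Y *m X *m S = S by case: pP.
move: e SP PS (adjmx_mpinv_mul wp XY); rewrite {}/S {pP}.
(* The adjoints are generalized, for [mulmxA] would reassociate the product
   that defines them. *)
move: (adjmx Wp Wq X) (adjmx Wq Wp Y) => Xs Ys e SP PS eP.
have := congr1 (fun Z => Xs *m Z *m X) e.
rewrite /= !mulmxA eP PQ -!mulmxA (mulmxA Y X) PS => ->.
by rewrite -PQ !mulmxA -(mulmxA _ Y X) SP.
Qed.

(** The self-adjointness of A B B^[†] A^[†] = A Q A^[†] is
    [adjmx_conj_mpinv] for A and Q; that of B^[†] P B is the adjoint of the same
    fact for B^[*] and P. *)
Lemma reverse_order_of_commute (C : numClosedFieldType) (m n l : nat)
    (M : 'M[C]_m) (N : 'M[C]_n) (L : 'M[C]_l)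
    (A : 'M[C]_(m, n)) (B : 'M[C]_(n, l))
    (Ad : 'M[C]_(n, m)) (Bd : 'M[C]_(l, n)) :
  is_weight M -> is_weight N -> is_weight L ->
  is_mpinv M N A Ad -> is_mpinv N L B Bd ->
  let S := adjmx M N A *m A in let T := B *m adjmx N L B in
  let P := Ad *m A in let Q := B *m Bd in
  Q *m S = S *m Q -> P *m T = T *m P -> is_mpinv M L (A *m B) (Bd *m Ad).
Proof.
move=> wM wN wL hA hB S T P Q QS PT.
have pP : range_projection N S P := mpinv_corange_projection wM wN hA.
have [AdK AK hAd hP] := hA; have [BdK BK hQ hBd] := hB.
have PQ : P *m Q = Q *m P := commute_range_projection wN hQ pP QS.
split.
- transitivity (A *m (Q *m P) *m B); first by rewrite /P /Q !mulmxA.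
  by rewrite -PQ /P /Q !mulmxA AdK -!mulmxA (mulmxA B) BdK.
- transitivity (Bd *m (P *m Q) *m Ad); first by rewrite /P /Q !mulmxA.
  by rewrite PQ /P /Q !mulmxA BK -!mulmxA (mulmxA Ad) AK.
- have := adjmx_conj_mpinv wM wN hA hQ QS.
  by rewrite /Q !mulmxA.
- have := adjmx_conj_mpinv wL wN (is_mpinv_adj wN wL hB) hP.
  rewrite /= adjmxK // => /(_ PT).
  have -> : adjmx N L B *m P *m adjmx L N Bd = adjmx L L (Bd *m P *m B).
    by rewrite !(adjmx_mul _ _ _ _ wN) hP mulmxA.
  by rewrite adjmxK // /P !mulmxA.
Qed.

(** The rank condition says that [w = row_mx As B *m K] vanishes as soon as
    A w = 0 and B^[*] w = 0, that is, P w = 0 and Q w = 0.  It is used for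
    w = P Q - Q P Q. *)
Lemma projections_commute_of_rank (C : numClosedFieldType) (m n l : nat)
    (M : 'M[C]_m) (N : 'M[C]_n) (L : 'M[C]_l)
    (A : 'M[C]_(m, n)) (B : 'M[C]_(n, l))
    (Ad : 'M[C]_(n, m)) (Bd : 'M[C]_(l, n)) :
  is_weight M -> is_weight N -> is_weight L ->
  is_mpinv M N A Ad -> is_mpinv N L B Bd ->
  let As := adjmx M N A in let Bs := adjmx N L B in
  let P := Ad *m A in let Q := B *m Bd in
  \rank (block_mx (Bs *m As) (Bs *m B) (A *m As) (A *m B))
    = \rank (row_mx As B) ->
  P *m Q *m P *m Q = P *m Q -> P *m Q = Q *m P.
Proof.
move=> wM wN wL hA hB As Bs P Q.
have -> : block_mx (Bs *m As) (Bs *m B) (A *m As) (A *m B)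
          = col_mx Bs A *m row_mx As B by rewrite mul_col_row.
move=> /mulmx_eq0_rank rk PQPQ.
have [AdK AK hAd hP] := hA; have [BdK BK hQ hBd] := hB.
have PP : P *m P = P by rewrite /P mulmxA AK.
have QQ : Q *m Q = Q by rewrite /Q mulmxA BdK.
have QPQ : Q *m P *m Q = P *m Q.
  pose K := col_mx (adjmx N M Ad *m Q) (- (Bd *m P *m Q)).
  have eK : row_mx As B *m K = P *m Q - Q *m P *m Q.
    rewrite mul_row_col mulmxA (adjmx_mpinv_mul wM hA) mulmxN.
    by rewrite /Q !mulmxA.
  suff YXK0 : col_mx Bs A *m row_mx As B *m K = 0.
    by have /eqP := rk _ K YXK0; rewrite eK subr_eq0 eq_sym => /eqP.
  rewrite -mulmxA eK mul_col_mx.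
  have -> : Bs *m (P *m Q - Q *m P *m Q) = 0.
    rewrite -[Bs](mpinv_adj_mul wN hB) -/Q -(mulmxA _ Q) mulmxBr.
    by rewrite -(mulmxA Q P) (mulmxA Q Q) QQ subrr mulmx0.
  have -> : A *m (P *m Q - Q *m P *m Q) = 0.
    rewrite -{1}AdK -(mulmxA A) -/P -(mulmxA A) mulmxBr (mulmxA P P) PP.
    by rewrite (mulmxA P _ Q) (mulmxA P Q P) PQPQ subrr mulmx0.
  by rewrite col_mx0.
by apply/esym/(compression_commute wN hQ QQ hP).
Qed.

(** The first Penrose equation for A B, multiplied by A^[†] and B^[†], is
    P Q P Q = P Q.  Once P and Q commute, the last two equations give the
    commutation relations, for A and Q and then for B^[*] and P. *)
Lemma commute_of_mpinv_mul (C : numClosedFieldType) (m n l : nat)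
    (M : 'M[C]_m) (N : 'M[C]_n) (L : 'M[C]_l)
    (A : 'M[C]_(m, n)) (B : 'M[C]_(n, l))
    (Ad : 'M[C]_(n, m)) (Bd : 'M[C]_(l, n)) :
  is_weight M -> is_weight N -> is_weight L ->
  is_mpinv M N A Ad -> is_mpinv N L B Bd ->
  let As := adjmx M N A in let Bs := adjmx N L B in
  let S := As *m A in let T := B *m Bs in
  let P := Ad *m A in let Q := B *m Bd in
  \rank (block_mx (Bs *m As) (Bs *m B) (A *m As) (A *m B))
    = \rank (row_mx As B) ->
  is_mpinv M L (A *m B) (Bd *m Ad) -> Q *m S = S *m Q /\ P *m T = T *m P.
Proof.
move=> wM wN wL hA hB As Bs S T P Q rk [ABK _ hAB hBA].
have [_ _ _ hP] := hA; have [_ _ hQ _] := hB.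
have PQ : P *m Q = Q *m P.
  apply: (projections_commute_of_rank wM wN wL hA hB rk).
  by have := congr1 (fun Z => Ad *m Z *m Bd) ABK; rewrite /P /Q !mulmxA.
split.
  apply: (commute_of_conj_mpinv wM wN hA hQ PQ).
  by move: hAB; rewrite /Q !mulmxA.
have := commute_of_conj_mpinv wL wN (is_mpinv_adj wN wL hB) hP.
rewrite /= adjmxK // -(adjmx_mul _ _ _ _ wL) hQ; apply; first by rewrite PQ.
have -> : adjmx N L B *m P *m adjmx L N Bd = adjmx L L (Bd *m P *m B).
  by rewrite !(adjmx_mul _ _ _ _ wN) hP mulmxA.
have e : adjmx L L (Bd *m P *m B) = Bd *m P *m B.
  by move: hBA; rewrite /P !mulmxA.
by rewrite !e.
Qed.

Theorem theorem3p16 (R : realType) (m n l : nat)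
    (A : 'M[R[i]]_(m, n)) (B : 'M[R[i]]_(n, l))
    (M : 'M[R[i]]_m) (N : 'M[R[i]]_n) (L : 'M[R[i]]_l)
    (Ad : 'M[R[i]]_(n, m)) (Bd : 'M[R[i]]_(l, n)) :
  is_weight M -> is_weight N -> is_weight L ->
  is_mpinv M N A Ad -> is_mpinv N L B Bd ->
  let As := adjmx M N A in
  let Bs := adjmx N L B in
  \rank (block_mx (Bs *m As) (Bs *m B) (A *m As) (A *m B))
    = \rank (row_mx As B) ->
  let reverse_order_law :=
    exists2 Z : 'M[R[i]]_(l, m), is_mpinv M L (A *m B) Z & Z = Bd *m Ad in
  [/\ reverse_order_law <-> range_hermitian N (As *m A *m B *m Bs),
      reverse_order_law <->
        (mxrange (As *m A *m B) `<=` mxrange B /\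
         mxrange (B *m Bs *m As) `<=` mxrange As),
      reverse_order_law <->
        (range_hermitian N (B *m Bd *m As *m A) /\
         range_hermitian N (Ad *m A *m B *m Bs))
    & reverse_order_law <->
        (B *m Bd *m As *m A *m B = As *m A *m B /\
         Ad *m A *m B *m Bs *m As = B *m Bs *m As)].
Proof.
move=> wM wN wL hA hB As Bs rk rol.
pose S := As *m A; pose T := B *m Bs; pose P := Ad *m A; pose Q := B *m Bd.
have hS : adjmx N N S = S := adjmx_gram A wM wN.
have hT : adjmx N N T = T := adjmx_cogram B wN wL.
have pP : range_projection N S P := mpinv_corange_projection wM wN hA.
have pQ : range_projection N T Q := mpinv_range_projection wN hB.
have [hP _ _] := pP; have [hQ _ _] := pQ.
have PP := range_projection_idem pP; have QQ := range_projection_idem pQ.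
have rolE : rol <-> Q *m S = S *m Q /\ P *m T = T *m P.
  split=> [[Z hZ eZ] | [QS PT]].
    by rewrite eZ in hZ; apply: commute_of_mpinv_mul rk hZ.
  have hZ := reverse_order_of_commute wM wN wL hA hB QS PT.
  exact: (ex_intro2 _ _ (Bd *m Ad) hZ erefl).
have [BdK _ _ _] := hB.
have hAs := is_mpinv_adj wM wN hA.
have eP : As *m adjmx N M Ad = P := adjmx_mpinv_mul wM hA.
have fixB := mul_mpinv_fix_commute wN hB hS.
have fixA : P *m (T *m As) = T *m As <-> P *m T = T *m P.
  by rewrite -eP; apply: mul_mpinv_fix_commute wN hAs hT.
have AsK : As *m adjmx N M Ad *m As = As by case: hAs.
have subB := mxrange_sub_fix (S *m B) BdK.
have subA := mxrange_sub_fix (T *m As) AsK; rewrite eP in subA.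
split; apply: (iff_trans rolE); apply: iff_sym.
- by rewrite -(mulmxA S); exact: (range_hermitian_mul wN hS hT pP pQ).
- exact: (Morphisms_Prop.and_iff_morphism _ _ (iff_trans subB fixB)
                                        _ _ (iff_trans subA fixA)).
- rewrite -(mulmxA _ As A) -(mulmxA P B Bs).
  have hermQ := range_hermitian_compression wN hQ QQ hS.
  have hermP := range_hermitian_compression wN hP PP hT.
  exact: (Morphisms_Prop.and_iff_morphism _ _ hermQ _ _ hermP).
- rewrite -(mulmxA _ As A) -(mulmxA Q S) -(mulmxA P B Bs) -(mulmxA P T).
  exact: (Morphisms_Prop.and_iff_morphism _ _ fixB _ _ fixA).
Qed.
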